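(* Let $n \geq 2$. Any problem $f$ satisfying (i) $\mathsf{LPO} \le^*_W f <^*_W \mathsf{LPO}^{[n]}$, or (ii) $\mathsf{LLPO} \le^*_W f <^*_W \mathsf{LLPO}^{[n]}$, does not have an $m$-th root for any $m \geq n$.
   Context: A problem is a partial multivalued function $f:\subseteq \mathbb{N}^\mathbb{N} \rightrightarrows \mathbb{N}^\mathbb{N}$; $\mathrm{dom}(f)$ is the set of $x$ with $f(x)\neq\emptyset$. Fix a standard computable pairing $\langle x,y\rangle$. $f \le_W g$ iff there are partial computable $h,k:\subseteq\mathbb{N}^\mathbb{N}\to\mathbb{N}^\mathbb{N}$ such that for every $x\in\mathrm{dom}(f)$, $k(x)\in\mathrm{dom}(g)$ and for every $y\in g(k(x))$, $h(\langle x,y\rangle)\in f(x)$; $f\equiv_W g$ means both directions. $f\le^*_W g$ (continuous Weihrauch reducibility) is defined the same way but with $h,k$ only required to be partial continuous; $f\equiv^*_W g$ means both directions, and $f<^*_W g$ means $f\le^*_W g$ and not $f\equiv^*_W g$. The composition $f\circ g$ has domain $\{x\in\mathrm{dom}(g) : g(x)\subseteq \mathrm{dom}(f)\}$ and $(f\circ g)(x)=\{z : \exists y\in g(x),\ z\in f(y)\}$. The compositional product $f*g$ is a $\le_W$-maximum of $\{f'\circ g' : f'\le_W f,\ g'\le_W g\}$. $f^{[0]}:=\mathrm{id}$, $f^{[n]}$ is the compositional product of $n$ copies of $f$; for $m\ge 2$, $r$ is an $m$-th root of $f$ iff $f\equiv_W r^{[m]}$. With $\mathbf{n}$ the constant sequence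 of value $n$: $\mathsf{LPO}(x)=\mathbf{0}$ if $x$ has a zero entry and $\mathbf{1}$ otherwise (total). $\mathsf{LLPO}$ has domain the sequences with at most one non-zero entry, and $\mathsf{LLPO}(x)$ contains $\mathbf{0}$ iff $x$ is zero at all even indices, and contains $\mathbf{1}$ iff $x$ is zero at all odd indices. *)

(* Defs.v *)
From Stdlib Require Cantor.
From HB Require Import structures.
From mathcomp Require Import all_boot all_order all_algebra.
From mathcomp Require Import all_classical topology.

Set Implicit Arguments.
Unset Strict Implicit.
Unset Printing Implicit Defensive.

Local Open Scope classical_set_scope.

(* The product topology of the discrete spaces [nat]. *)
Definition baire := prod_topology (fun _ : nat => nat).
HB.instance Definition _ := Topological.on baire.

(* <x, y> = x 0, y 0, x 1, y 1, ... *)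
Definition bpair (x y : baire) : baire :=
  fun n => if odd n then y n./2 else x n./2.

(* The values of [pfun_val] outside [pfun_dom] carry no information. *)
Record partial_fun := PartialFun {
  pfun_dom : set baire;
  pfun_val :> baire -> baire }.

(* Oracle computability: unary partial recursive functions relative to an
   oracle in [nat -> nat]; several arguments are passed as nested pairs, with
   the Cantor bijection [Cantor.to_nat : nat * nat -> nat]. *)
Inductive code : Type :=
| Zero | Succ | Fst | Snd | Oracle
| Pair of code & code
| Comp of code & code
| Prec of code & code
| Mu of code.

Definition npair (m n : nat) : nat := Cantor.to_nat (m, n).

(* [code_eval x c n v]: the program [c] with oracle [x] halts on input [n] with
   output [v]. *)
Inductive code_eval (x : nat -> nat) : code -> nat -> nat -> Prop :=
| eval_zero n : code_eval x Zero n 0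
| eval_succ n : code_eval x Succ n n.+1
| eval_fst m n : code_eval x Fst (npair m n) m
| eval_snd m n : code_eval x Snd (npair m n) n
| eval_oracle n : code_eval x Oracle n (x n)
| eval_pair a b n u v :
    code_eval x a n u -> code_eval x b n v -> code_eval x (Pair a b) n (npair u v)
| eval_comp a b n u v :
    code_eval x b n u -> code_eval x a u v -> code_eval x (Comp a b) n v
| eval_prec0 a b n v :
    code_eval x a n v -> code_eval x (Prec a b) (npair n 0) v
| eval_precS a b n k u v :
    code_eval x (Prec a b) (npair n k) u ->
    code_eval x b (npair n (npair k u)) v ->
    code_eval x (Prec a b) (npair n k.+1) v
| eval_mu a n k (w : nat -> nat) :
    (forall j, j < k -> code_eval x a (npair n j) (w j).+1) ->
    code_eval x a (npair n k) 0 ->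
    code_eval x (Mu a) n k.

(* As usual for realizers, the program may also halt outside the domain. *)
Definition computable (F : partial_fun) : Prop :=
  exists c : code, forall x, pfun_dom F x -> forall n, code_eval x c n (F x n).

Definition partial_continuous (F : partial_fun) : Prop :=
  {within pfun_dom F, continuous F}.

Definition problem := baire -> set baire.

Definition dom (f : problem) : set baire := [set x | f x !=set0].

Definition reducible (C : partial_fun -> Prop) (f g : problem) : Prop :=
  exists h k : partial_fun, [/\ C h, C k &
    forall x, dom f x ->
      [/\ pfun_dom k x, dom g (k x) &
        forall y, g (k x) y ->
          pfun_dom h (bpair x y) /\ f x (h (bpair x y))]].

Definition leW : problem -> problem -> Prop := reducible computable.
Definition eqW (f g : problem) : Prop := leW f g /\ leW g f.

Definition leWc : problem -> problem -> Prop := reducible partial_continuous.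
Definition eqWc (f g : problem) : Prop := leWc f g /\ leWc g f.
Definition ltWc (f g : problem) : Prop := leWc f g /\ ~ eqWc f g.

Definition problem_id : problem := fun x => [set x].

Definition problem_comp (f g : problem) : problem := fun x =>
  [set z | dom g x /\ g x `<=` dom f /\ exists2 y, g x y & f y z].

(* The compositional product [f * g] is only determined up to [eqW], hence it
   is a relation: [p] is a maximum of the problems [f' o g'], for [f' <= f] and
   [g' <= g]. *)
Definition is_comp_product (f g p : problem) : Prop :=
  (exists f' g', [/\ leW f' f, leW g' g & p = problem_comp f' g']) /\
  (forall f' g', leW f' f -> leW g' g -> leW (problem_comp f' g') p).

(* [is_power f n p]: [p] represents the degree [f^[n]]. *)
Inductive is_power (f : problem) : nat -> problem -> Prop :=
| is_power0 : is_power f 0 problem_id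
| is_power1 : is_power f 1 f
| is_powerS n p q :
    is_power f n.+1 p -> is_comp_product f p q -> is_power f n.+2 q.

Definition is_root (m : nat) (r f : problem) : Prop :=
  exists2 p, is_power r m p & eqW f p.

Definition ltWc_power (f g : problem) (n : nat) : Prop :=
  exists2 p, is_power g n p & ltWc f p.

Definition bcst (n : nat) : baire := fun _ => n.

Definition LPO : problem := fun x =>
  [set y | ((exists i, x i = 0) /\ y = bcst 0) \/
           (~ (exists i, x i = 0) /\ y = bcst 1)].

Definition LLPO : problem := fun x =>
  [set y | (forall i j, x i <> 0 -> x j <> 0 -> i = j) /\
           (((forall i, x i.*2 = 0) /\ y = bcst 0) \/
            ((forall i, x i.*2.+1 = 0) /\ y = bcst 1))].

(* Main.v *)
From Stdlib Require Cantor.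
From mathcomp Require Import all_boot all_classical topology.
Require Import Defs.

(* Say that [g] clusters if, for all sequences a_i (one for each i in I) of
   instances converging to an instance z, some solution y of z is a cluster
   point, for every i, of solutions of the a_i(k).  This property is inherited
   by compositions and by problems continuously below [g], hence passes from [r]
   to its powers.  For I a singleton it characterizes the problems not above
   LPO, and for I of size two those not above LLPO.  Thus if LPO is below
   f = r^[m] then it is already below [r], so LPO^[n] is below r^[n], hence
   below r^[m] = f when n <= m; similarly for LLPO.

   The power r^[m] is a maximum for computable reductions only.  It still bounds
   compositions of problems continuously below [r], because a continuous
   function is computable from an oracle, which can be carried along with the
   instances. *)

Set Implicit Arguments.
Unset Strict Implicit.
Unset Printing Implicit Defensive.

Local Open Scope classical_set_scope.

(** * Baire space and continuous reducibility *)

Definition agree (N : nat) (x y : baire) := forall i, i < N -> x i = y i.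

Lemma agreeW M N x y : M <= N -> agree N x y -> agree M x y.
Proof. by move=> le_MN xy i iM; apply: xy; exact: leq_trans iM le_MN. Qed.

Lemma agree_trans N x y z : agree N x y -> agree N y z -> agree N x z.
Proof. by move=> xy yz i iN; rewrite xy // yz. Qed.

Lemma agree_sym N x y : agree N x y -> agree N y x.
Proof. by move=> xy i iN; rewrite xy. Qed.

Lemma nbhs_agree (x : baire) N : nbhs x [set y | agree N x y].
Proof.
elim: N => [|N IHN]; first by apply: filterS (@filterT _ (nbhs x) _).
have xN : nbhs x [set y : baire | y N = x N].
  have := @proj_continuous nat (fun=> nat) N x.
  by move=> /(_ [set x N]); apply; exact: discrete_set1.
apply: filterS2 IHN xN => y /= xy yN i.
by rewrite ltnS leq_eqVlt => /orP[/eqP ->//|]; exact: xy.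
Qed.

Lemma nbhs_baireP (x : baire) (A : set baire) :
  nbhs x A <-> exists N, [set y | agree N x y] `<=` A.
Proof.
split=> [|[N NA]]; last by apply: filterS NA (nbhs_agree x N).
pose F : set_system baire := filter_from setT (fun N => [set y | agree N x y]).
have FF : Filter F.
  apply: filter_from_filter; first by exists 0.
  move=> M N _ _; exists (maxn M N) => // y xy; split; apply: agreeW xy.
    exact: leq_maxl.
  exact: leq_maxr.
(* The product topology is the supremum of the topologies induced by the projections, so convergence
   of the cylinder filter can be checked one coordinate at a time. *)
suff Fx : F --> x by move=> /Fx [N _ NA]; exists N.
apply/cvg_sup => i.
move=> B /= [_ [[C _ <-] Cx CB]].
by exists i.+1 => // y xy; apply: CB; rewrite /= -xy.
Qed.

Definition continuous_on (D : set baire) (F : baire -> baire) :=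
  forall x N, D x -> exists M, forall y, D y -> agree M x y -> agree N (F x) (F y).

Lemma continuous_onP (F : partial_fun) :
  partial_continuous F <-> continuous_on (pfun_dom F) F.
Proof.
split=> [/subspace_continuousP Fc x N Fx|Fc].
  have /nbhs_baireP[M MF] := Fc x Fx _ (nbhs_agree (F x) N).
  by exists M => y Fy xy; apply: MF.
apply/subspace_continuousP => x Fx A /nbhs_baireP[N NA].
have [M MF] := Fc x N Fx.
by apply/nbhs_baireP; exists M => y xy Fy; apply: NA; exact: MF.
Qed.

Lemma continuous_on_pointwise D F :
  (forall x n, D x ->
     exists N, forall y, D y -> agree N x y -> F x n = F y n) ->
  continuous_on D F.
Proof.
move=> Fc x N Dx; elim: N => [|N [M IHM]]; first by exists 0.
have [K FK] := Fc x N Dx; exists (maxn M K) => y Dy xy i.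
rewrite ltnS leq_eqVlt => /orP[/eqP ->|].
  by apply: FK => //; apply: agreeW xy; exact: leq_maxr.
by apply: IHM => //; apply: agreeW xy; exact: leq_maxl.
Qed.

(** * Oracle computations and their continuity *)

Lemma npair_inj m n m' n' : npair m n = npair m' n' -> m = m' /\ n = n'.
Proof. by move=> /Cantor.to_nat_inj[-> ->]. Qed.

(** [npair] is not a constructor, so inversion leaves equations between pair codes; they appear here
    in a form that [npair_inj] can resolve. *)
Lemma code_eval_inv x c n v : code_eval x c n v ->
  match c with
  | Zero => v = 0
  | Succ => v = n.+1
  | Fst => exists m, n = npair v m
  | Snd => exists m, n = npair m v
  | Oracle => v = x n
  | Pair a b => exists u w, [/\ v = npair u w, code_eval x a n u & code_eval x b n w]
  | Comp a b => exists2 u, code_eval x b n u & code_eval x a u v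
  | Prec a b =>
      (exists2 m, n = npair m 0 & code_eval x a m v) \/
      (exists m k u, [/\ n = npair m k.+1, code_eval x (Prec a b) (npair m k) u &
                         code_eval x b (npair m (npair k u)) v])
  | Mu a => code_eval x a (npair n v) 0 /\
      exists w, forall j, j < v -> code_eval x a (npair n j) (w j).+1
  end.
Proof.
case=> //.
- by move=> m k; exists k.
- by move=> m k; exists m.
- by move=> a b k u w; exists u, w.
- by move=> a b k u w; exists u.
- by move=> a b k u; left; exists k.
- by move=> a b m k u w; right; exists m, k, u.
- by move=> a m k w; split=> //; exists w.
Qed.

Lemma code_eval_fun x c n v v' : code_eval x c n v -> code_eval x c n v' -> v = v'.
Proof.
move=> cv; elim: cv v' => {c n v} [n|n|m n|m n|n|a b n u v _ IHa _ IHb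
  |a b n u v _ IHb _ IHa|a b n v _ IHa|a b n k u v _ IHp _ IHb|a n k w _ IHw _ IHk] v'
  /code_eval_inv => //.
- by case=> m' /npair_inj[].
- by case=> m' /npair_inj[].
- by case=> u' [w' [-> /IHa<- /IHb<-]].
- by case=> u' /IHb<- /IHa.
- by case=> [[m' /npair_inj[<- _] /IHa]|[m' [k' [u' [/npair_inj[]]]]]].
- case=> [[m' /npair_inj[]]//|[m' [k' [u' [/npair_inj[<- [<-]] /IHp<- /IHb]]]]] //.
(* Two outcomes of one search coincide: at the smaller one the body would return both 0 and a
   successor. *)
- case=> ev [w' ew']; have [kv|vk|//] := ltngtP k v'.
    by have := IHk _ (ew' _ kv).
  by have := IHw _ vk _ ev.
Qed.

(** Use principle: a halting run consults only finitely many oracle entries. *)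
Lemma code_eval_use (x : baire) c n v : code_eval x c n v ->
  exists N, forall y : baire, agree N x y -> code_eval y c n v.
Proof.
elim=> {c n v} [n|n|m n|m n|n|a b n u v _ [M HM] _ [N HN]
  |a b n u v _ [M HM] _ [N HN]|a b n v _ [M HM]|a b n k u v _ [M HM] _ [N HN]
  |a n k w _ IHw _ [M HM]].
- by exists 0 => *; constructor.
- by exists 0 => *; constructor.
- by exists 0 => *; constructor.
- by exists 0 => *; constructor.
- by exists n.+1 => y xy; rewrite (xy n) //; constructor.
- exists (maxn M N) => y xy; constructor.
    by apply: HM; apply: agreeW xy; exact: leq_maxl.
  by apply: HN; apply: agreeW xy; exact: leq_maxr.
- exists (maxn M N) => y xy; apply: (eval_comp (u := u)).
    by apply: HM; apply: agreeW xy; exact: leq_maxl.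
  by apply: HN; apply: agreeW xy; exact: leq_maxr.
- by exists M => y xy; constructor; apply: HM.
- exists (maxn M N) => y xy; apply: (eval_precS (u := u)).
    by apply: HM; apply: agreeW xy; exact: leq_maxl.
  by apply: HN; apply: agreeW xy; exact: leq_maxr.
(* The finitely many runs below [k] have a common use bound. *)
- have [K HK] : exists K, forall j, j < k -> forall y : baire, agree K x y ->
      code_eval y a (npair n j) (w j).+1.
    elim: k IHw {HM} => [|k IHk] IHw; first by exists 0.
    have [|K HK] := IHk; first by move=> j jk; apply: IHw; exact: ltnW.
    have [L HL] := IHw k (ltnSn k); exists (maxn K L) => j.
    rewrite ltnS leq_eqVlt => /orP[/eqP ->|jk] y xy.
      by apply: HL; apply: agreeW xy; exact: leq_maxr.
    by apply: HK => //; apply: agreeW xy; exact: leq_maxl.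
  exists (maxn M K) => y xy; apply: (eval_mu (w := w)).
    by move=> j jk; apply: HK => //; apply: agreeW xy; exact: leq_maxr.
  by apply: HM; apply: agreeW xy; exact: leq_maxl.
Qed.

(** By the use principle the run on [x] is also a run on every nearby [y]; determinism identifies
    its output with [F y n]. *)
Lemma computable_continuous F : computable F -> partial_continuous F.
Proof.
move=> [c cF]; apply/continuous_onP/continuous_on_pointwise => x n Fx.
have [N HN] := code_eval_use (cF x Fx n).
by exists N => y Fy /HN /code_eval_fun; apply; exact: cF.
Qed.

Lemma leW_leWc f g : leW f g -> leWc f g.
Proof.
by move=> [h [k [/computable_continuous ch /computable_continuous ck fg]]]; exists h, k.
Qed.

(** * Pairing and transitivity of continuous reducibility *)

Definition evens (x : baire) : baire := fun n => x n.*2.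
Definition odds (x : baire) : baire := fun n => x n.*2.+1.

Lemma bpairKl x y : evens (bpair x y) = x.
Proof. by apply/funext => n; rewrite /evens /bpair odd_double doubleK. Qed.

Lemma bpairKr x y : odds (bpair x y) = y.
Proof. by apply/funext => n; rewrite /odds /bpair /= odd_double uphalf_double. Qed.

Lemma agree_evens N x y : agree N.*2 x y -> agree N (evens x) (evens y).
Proof. by move=> xy i iN; apply: xy; rewrite ltn_double. Qed.

Lemma agree_odds N x y : agree N.*2 x y -> agree N (odds x) (odds y).
Proof. by move=> xy i iN; apply: xy; rewrite ltn_Sdouble. Qed.

Lemma agree_bpair N x y x' y' :
  agree N x x' -> agree N y y' -> agree N (bpair x y) (bpair x' y').
Proof.
move=> xx' yy' i iN; rewrite /bpair.
have iN2 : i./2 < N.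
  by apply: leq_ltn_trans iN; rewrite leq_half_double leqW -?addnn ?leq_addr.
by case: ifP; rewrite ?xx' ?yy'.
Qed.

Lemma continuous_on_comp D E F G : continuous_on D F -> continuous_on E G ->
  (forall x, D x -> E (F x)) -> continuous_on D (G \o F).
Proof.
move=> cF cG DE x N Dx; have [M GM] := cG (F x) N (DE x Dx).
by have [K FK] := cF x M Dx; exists K => y Dy /(FK _ Dy); apply: GM; exact: DE.
Qed.

Lemma continuous_on_evens D : continuous_on D evens.
Proof. by move=> x N _; exists N.*2 => y _; exact: agree_evens. Qed.

Lemma continuous_on_odds D : continuous_on D odds.
Proof. by move=> x N _; exists N.*2 => y _; exact: agree_odds. Qed.

Lemma continuous_on_bpair D F G : continuous_on D F -> continuous_on D G ->
  continuous_on D (fun x => bpair (F x) (G x)).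
Proof.
move=> cF cG x N Dx; have [M FM] := cF x N Dx; have [K GK] := cG x N Dx.
exists (maxn M K) => y Dy xy; apply: agree_bpair.
  by apply: FM => //; apply: agreeW xy; exact: leq_maxl.
by apply: GK => //; apply: agreeW xy; exact: leq_maxr.
Qed.

Lemma leWcP f g : leWc f g <-> exists (D E : set baire) h k,
  [/\ continuous_on D h, continuous_on E k & forall x, dom f x ->
   [/\ E x, dom g (k x) & forall y, g (k x) y -> D (bpair x y) /\ f x (h (bpair x y))]].
Proof.
split=> [[h [k [/continuous_onP ch /continuous_onP ck fg]]]|[D [E [h [k [ch ck fg]]]]]].
  by exists (pfun_dom h), (pfun_dom k), h, k.
by exists (PartialFun D h), (PartialFun E k); split=> //; exact/continuous_onP.
Qed.

Lemma leWc_trans g f h : leWc f g -> leWc g h -> leWc f h.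
Proof.
move=> /leWcP[D1 [E1 [h1 [k1 [ch1 ck1 fg]]]]] /leWcP[D2 [E2 [h2 [k2 [ch2 ck2 gh]]]]].
(* For [u = bpair x y], [in2 u] is [bpair (k1 x) y], the argument of [h2], and [in1 u] is the
   resulting argument of [h1]. *)
pose in2 u := bpair (k1 (evens u)) (odds u).
pose in1 u := bpair (evens u) (h2 (in2 u)).
pose E := [set x | E1 x /\ E2 (k1 x)].
pose D := [set u | [/\ E1 (evens u), D2 (in2 u) & D1 (in1 u)]].
have cin2 : continuous_on D in2.
  apply: continuous_on_bpair; last exact: continuous_on_odds.
  by apply: (continuous_on_comp (E := E1)) => // [|u []//]; exact: continuous_on_evens.
apply/leWcP; exists D, E, (h1 \o in1), (k2 \o k1); split.
- apply: (continuous_on_comp (E := D1)) => // [|u []//].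
  apply: continuous_on_bpair; first exact: continuous_on_evens.
  by apply: (continuous_on_comp (E := D2)) => // u [].
- apply: (continuous_on_comp (E := E2)) => //; last by move=> x [].
  by move=> x N [E1x _]; have [M HM] := ck1 x N E1x; exists M => y [+ _]; exact: HM.
- move=> x /fg[E1x gx fgx]; have [E2x hx ghx] := gh _ gx; split=> // y /ghx[D2y gy].
  by have [D1y fy] := fgx _ gy; rewrite /D /= /in1 /in2 !bpairKl !bpairKr.
Qed.

(** * Problems not above LPO or LLPO *)

Definition tends (I : Type) (a : I -> nat -> baire) (z : baire) :=
  forall N, exists M, forall i k, M <= k -> agree N z (a i k).

Definition clusters (I : Type) (g : problem) :=
  forall (a : I -> nat -> baire) z, dom g z -> (forall i k, dom g (a i k)) ->
    tends a z ->
  exists2 y, g z y &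
    forall i N, exists2 k, N <= k & exists2 y', g (a i k) y' & agree N y y'.

(** The map [k] turns the given sequences into sequences converging to [k z], and [h] carries the
    cluster point back, being continuous at [bpair z y]. *)
Lemma clusters_leWc I f g : leWc f g -> clusters I g -> clusters I f.
Proof.
move=> /leWcP[D [E [h [k [ch ck fg]]]]] cl_g a z fz fa az.
have [Ez gkz gz] := fg z fz.
have [i n|N|y gy yN] := cl_g (fun i n => k (a i n)) (k z) gkz.
- by have [] := fg _ (fa i n).
- have [M kM] := ck z N Ez; have [K aK] := az M.
  by exists K => i n /(aK i); apply: kM; have [] := fg _ (fa i n).
have [Dzy fzh] := gz y gy; exists (h (bpair z y)) => // i N.
have [M hM] := ch _ N Dzy; have [K aK] := az M.
(* The bound [K] makes the instances agree up to the modulus [M] of [h], the bound [M] does so for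
   the solutions, and [N] is the bound asked for. *)
have [n Kn [y' gy' yy']] := yN i (maxn N (maxn M K)).
have [_ _ /(_ y' gy')[Dy' fy']] := fg _ (fa i n).
move: Kn; rewrite !geq_max => /and3P[Nn _ Kn].
exists n => //; exists (h (bpair (a i n) y')) => //.
apply: hM => //; apply: agree_bpair; first exact: aK.
by apply: agreeW yy'; rewrite leq_max leq_maxl orbT.
Qed.

(** Choosing for each [i] and [N] a solution that agrees with [y] up to [N] gives sequences of
    instances of [f] that tend to [y]; clustering of [f] applies to them. *)
Lemma clusters_comp I f g :
  clusters I f -> clusters I g -> clusters I (problem_comp f g).
Proof.
move=> cl_f cl_g a z [w [gz [gzf [y0 _ _]]]] fga az.
have ga i k : dom g (a i k) by have [? []] := fga i k.
have gf i k : g (a i k) `<=` dom f by have [? [_ []]] := fga i k.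
have [y gy yN] := cl_g a z gz ga az.
have /choice[b bP] : forall iN, exists b : nat * baire,
    [/\ iN.2 <= b.1, g (a iN.1 b.1) b.2 & agree iN.2 y b.2].
  by case=> i N; have [k Nk [y' gy' yy']] := yN i N; exists (k, y').
have [|i k|N|u fu uN] := cl_f (fun i N => (b (i, N)).2) y.
- exact: gzf.
- by have [_ /gf] := bP (i, k).
- by exists N => i k Nk; have [_ _ /(agreeW Nk)] := bP (i, k).
exists u; first by split=> //; split=> //; exists y.
move=> i N; have [k Nk [u' fu' uu']] := uN i N; have [/= kb gb _] := bP (i, k).
exists (b (i, k)).1; first exact: leq_trans Nk kb.
by exists u' => //; split=> //; split=> //; exists (b (i, k)).2.
Qed.

Lemma clusters_id I : clusters I problem_id.
Proof.
move=> a z _ _ az; exists z => // i N; have [M aM] := az N.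
exists (maxn M N); first exact: leq_maxr.
by exists (a i (maxn M N)) => //; apply: aM; exact: leq_maxl.
Qed.

Lemma clusters_power I r m p : clusters I r -> is_power r m p -> clusters I p.
Proof.
move=> cl_r; elim=> {m p} [||m p q _ cl_p [[r' [p' [rr' pp' ->]]] _]] //.
  exact: clusters_id.
by apply: clusters_comp; [apply: clusters_leWc cl_r|apply: clusters_leWc cl_p];
  exact: leW_leWc.
Qed.

(** * [LPO] and [LLPO] do not cluster *)

Definition spike (p : nat) : baire := fun n => nat_of_bool (n == p).

Lemma tends_spike (I : Type) (e : I -> nat -> nat) :
  (forall i k, k <= e i k) -> tends (fun i k => spike (e i k)) (bcst 0).
Proof.
move=> ek N; exists N => i k Nk j jN; rewrite /spike; case: eqP => // je.
by move: jN; rewrite je ltnNge (leq_trans Nk (ek i k)).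
Qed.

(** Sequences with a single zero, moving off to infinity, tend to [bcst 1]; their only solution is
    [bcst 0], that of the limit is [bcst 1]. *)
Lemma LPO_not_clusters : ~ clusters unit LPO.
Proof.
move=> /(_ (fun _ k n => 1 - spike k n) (bcst 1)).
have LPO_dom x : dom LPO x.
  have [x0|x1] := pselect (exists i, x i = 0); first by exists (bcst 0); left.
  by exists (bcst 1); right.
case=> // [N|y [[[i//]]|[_ ->]] /(_ tt 1)[k _ [y' LPOy' y1]]].
  have [M sM] := @tends_spike unit (fun=> id) (fun=> leqnn) N.
  exists M => i k /(sM i) s j /s.
  by rewrite /bcst => <-.
case: LPOy' y1 => [[_ ->] /(_ 0 isT)//|[H _]] _; apply: H.
by exists k; rewrite /spike eqxx.
Qed.

(** Spikes at even positions have only the solution [bcst 1], spikes at odd positions only [bcst 0].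
    Both families tend to [bcst 0], and each solution there is missed by one of them. *)
Lemma LLPO_not_clusters : ~ clusters bool LLPO.
Proof.
move=> /(_ (fun (i : bool) k => spike (i + k.*2)) (bcst 0)).
have nspike p q : spike p q <> 0 -> q = p by rewrite /spike; case: eqP.
case=> [|[|] k||y].
- by exists (bcst 0); split=> //; left.
- exists (bcst 0); split=> [i j /nspike-> /nspike->//|]; left; split=> // i.
  by rewrite /spike; case: eqP => // /(congr1 odd); rewrite /= !odd_double.
- exists (bcst 1); split=> [i j /nspike-> /nspike->//|]; right; split=> // i.
  by rewrite /spike; case: eqP => // /(congr1 odd); rewrite /= !odd_double.
- by apply: tends_spike => i k; rewrite -addnn addnA leq_addl.
case=> _ [[_ ->] /(_ false 1)|[_ ->] /(_ true 1)] [k _ [y' [_ +] y1]].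
  case=> [[/(_ k)]|[_ yE]]; first by rewrite /spike eqxx.
  by have := y1 0 isT; rewrite yE.
case=> [[_ yE]|[/(_ k)]]; last by rewrite /spike eqxx.
by have := y1 0 isT; rewrite yE.
Qed.

(** * Reductions to problems that do not cluster *)

Lemma not_clustersP (I : Type) g : ~ clusters I g ->
  exists (a : I -> nat -> baire) z, [/\ dom g z, forall i k, dom g (a i k),
    tends a z & forall y, g z y -> exists N i,
      forall k y', N <= k -> g (a i k) y' -> ~ agree N y y'].
Proof.
move=> ncl; apply: contrapT => H; apply: ncl => a z gz ga az.
apply: contrapT => H1; apply: H; exists a, z; split=> // y gy.
apply: contrapT => H2; apply: H1; exists y => // i N.
apply: contrapT => H3; apply: H2; exists N, i => k y' Nk gy' yy'; apply: H3.
by exists k => //; exists y'.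
Qed.

Definition first_index (b : pred nat) (x : baire) : option nat :=
  if pselect (exists n, b (x n)) is left ex then Some (ex_minn ex) else None.

Lemma first_indexP b x :
  (forall n, ~~ b (x n)) /\ first_index b x = None \/
  exists n, [/\ b (x n), forall i, i < n -> ~~ b (x i) & first_index b x = Some n].
Proof.
rewrite /first_index; case: pselect => [ex|nex]; [right|left].
  case: ex_minnP => n bn nmin; exists n; split=> // i; rewrite ltnNge.
  by apply: contra => /nmin.
by split=> // n; apply/negP => bn; apply: nex; exists n.
Qed.

Lemma first_index_Some b x n : first_index b x = Some n ->
  b (x n) /\ forall i, i < n -> ~~ b (x i).
Proof. by have [[_ ->]//|[m [bm minm ->]] [<-]] := first_indexP b x. Qed.

Lemma first_index_None b x n : first_index b x = None -> ~~ b (x n).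
Proof. by have [[]//|[m [_ _ ->]]] := first_indexP b x. Qed.

Lemma first_index_agree b x y n :
  agree n.+1 x y -> first_index b x = Some n -> first_index b y = Some n.
Proof.
move=> xy /first_index_Some[bn minn].
have [[/(_ n)]|[m [bm minm ->]]] := first_indexP b y; first by rewrite -xy // bn.
have [mn|nm|-> //] := ltngtP m n.
  by have := minn _ mn; rewrite xy ?bm // ltnS ltnW.
by have := minm _ nm; rewrite -xy // bn.
Qed.

Lemma first_index_ge b x y N n :
  agree N x y -> first_index b x = None -> first_index b y = Some n -> N <= n.
Proof.
move=> xy x0 /first_index_Some[bn _]; rewrite leqNgt; apply/negP => nN.
by have := first_index_None n x0; rewrite xy // bn.
Qed.

(** An entry satisfying [b] is an event. Without one, [k] feeds [z]; with a first event at [p], it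
    feeds [a (c p).1 (c p).2], which is close to [z] when [p] is large. Without an event, [h] finds
    from a solution [y] of [z] a branch [i] whose late solutions stay away from [y], and answers
    [lim i]. A late event with a solution near [y] then belongs to another branch [j], where
    [out j = lim i], so [h] is continuous. *)
Lemma not_clusters_leWc (I : Type) (P g : problem) (b : pred nat)
    (c : nat -> I * nat) (lim out : I -> baire) :
  (forall N, exists M, forall p, M <= p -> N <= (c p).2) ->
  (forall x i, dom P x -> first_index b x = None -> P x (lim i)) ->
  (forall x p, dom P x -> first_index b x = Some p -> P x (out (c p).1)) ->
  (forall i j, i <> j -> out j = lim i) ->
  ~ clusters I g -> leWc P g.
Proof.
move=> cN Plim Pout outE /not_clustersP[a [z [gz ga az sepa]]].
pose A N y := [set i : I | forall k y', N <= k -> g (a i k) y' -> ~ agree N y y'].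
have A_agree N y y' : agree N y y' -> A N y = A N y'.
  move=> yy'; apply/seteqP; split=> i Ai k w Nk gw yw; apply: (Ai k w) => //.
    exact: agree_trans yy' yw.
  by apply: agree_trans yw; exact: agree_sym.
pose s (y : baire) : baire := fun N => nat_of_bool `[<A N y !=set0>].
(* Entry [N] of [s y] depends only on the entries of [y] below [N]; this gains the one entry that
   [first_index_agree] asks for. *)
have s_agree N y y' : agree N y y' -> agree N.+1 (s y) (s y').
  by move=> yy' i; rewrite ltnS /s => iN; rewrite (A_agree _ _ _ (agreeW iN yy')).
(* Choosing from the image under [lim] gives the same answer for equal sets [A N y]; the default
   [bcst 0] is never reached on solutions of [z]. *)
pose sel y := if first_index (leq 1) (s y) is Some N
  then xget (bcst 0) (lim @` A N y) else bcst 0.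
have selP y : g z y -> exists N i,
    A N y i /\ forall y', agree N y y' -> sel y' = lim i.
  move=> /sepa[N [i Ni]].
  have [[/(_ N)]|[M []]] := first_indexP (leq 1) (s y).
    by rewrite /s; case: asboolP => // -[]; exists i.
  rewrite {1}/s; case: asboolP => // -[j Aj] _ _ sM.
  have [j' Aj' jE] : (lim @` A M y) (xget (bcst 0) (lim @` A M y)).
    by apply: xgetPex; exists (lim j), j.
  exists M, j'; split=> // y' yy'.
  by rewrite /sel (first_index_agree (s_agree _ _ _ yy') sM) -(A_agree _ _ _ yy').
pose k x := if first_index b x is Some p then a (c p).1 (c p).2 else z.
pose h u := if first_index b (evens u) is Some p then out (c p).1 else sel (odds u).
pose D := [set u | dom P (evens u) /\ g (k (evens u)) (odds u)].
apply/leWcP; exists D, (dom P), h, k; split.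
- move=> u N [Pu gu]; move Eu: (first_index b (evens u)) => [p|]; last first.
    have [|M [i [Ai seli]]] := selP (odds u); first by move: gu; rewrite /k Eu.
    have [K cK] := cN M; exists (maxn M K).*2 => v [Pv gv] uv.
    have /(agreeW (leq_maxl _ _)) o_uv := agree_odds uv.
    have /(agreeW (leq_maxr _ _)) e_uv := agree_evens uv.
    rewrite /h Eu seli //; case Ev: first_index => [p|]; last by rewrite seli.
    (* If the late event were in branch [i], then [odds v] would be a late solution of that branch
       agreeing with [odds u] up to [M]. *)
    rewrite (outE i) // => icp; have /cK Mp := first_index_ge e_uv Eu Ev.
    by apply: (Ai _ (odds v) Mp) o_uv; rewrite icp; move: gv; rewrite /k Ev.
  exists p.+1.*2 => v _ uv.
  by rewrite /h Eu (first_index_agree (agree_evens uv) Eu).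
- move=> x N Px; move Ex: (first_index b x) => [p|].
    by exists p.+1 => y _ xy; rewrite /k Ex (first_index_agree xy Ex).
  have [M aM] := az N; have [K cK] := cN M; exists K => y _ xy.
  rewrite /k Ex; case Ey: first_index => [p|//]; apply: aM; apply: cK.
  exact: first_index_ge xy Ex Ey.
- move=> x Px; split=> //; first by rewrite /k; case: first_index.
  move=> y gy; rewrite /D /= /h bpairKl bpairKr; split=> //.
  case Ex: first_index => [p|]; first exact: Pout.
  have [|N [i [_ ->//]]] := selP y; first by move: gy; rewrite /k Ex.
  exact: Plim.
Qed.

Lemma LPO_leWc g : ~ clusters unit g -> leWc LPO g.
Proof.
(* The event is a zero entry. With a single branch, the condition relating [out] and [lim] is
   vacuous. *)
apply: (@not_clusters_leWc _ _ _ (pred1 0) (pair tt) (fun=> bcst 1) (fun=> bcst 0)).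
- by move=> N; exists N.
- move=> x _ _ x0; right; split=> // -[i xi].
  by have := first_index_None i x0; rewrite /= xi.
- by move=> x p _ /first_index_Some[/eqP xp _]; left; split=> //; exists p.
- by case; case.
Qed.

Lemma LLPO_leWc g : ~ clusters bool g -> leWc LLPO g.
Proof.
(* The event is a non-zero entry, and its parity selects the branch. The zero sequence admits both
   answers, so [lim] may depend on the branch. *)
apply: (@not_clusters_leWc _ _ _ (leq 1) (fun p => (odd p, p./2))
  (fun i => bcst i) (fun i => bcst (~~ i))).
- by move=> N; exists N.*2 => p Np /=; rewrite geq_half_double.
- move=> x i [y [x1 _]] x0.
  have {x0} x0 n : x n = 0 by have := first_index_None n x0; case: (x n).
  by split=> //; case: i; [right|left].
- move=> x p [y [x1 _]] /first_index_Some[xp _].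
  have xq q : q != p -> x q = 0.
    move=> /eqP qp; apply: contrapT => xq; apply: qp; apply: x1 => //.
    by case: (x p) xp.
  split=> //=; case op: (odd p); [left|right]; split=> // j; apply: xq;
    by apply/eqP => jp; move: op; rewrite -jp /= odd_double.
- by case; case.
Qed.

(** * Relativized composition *)

Definition nfst (n : nat) : nat := (Cantor.of_nat n).1.
Definition nsnd (n : nat) : nat := (Cantor.of_nat n).2.

Lemma nfstK m n : nfst (npair m n) = m.
Proof. by rewrite /nfst Cantor.cancel_of_to. Qed.

Lemma nsndK m n : nsnd (npair m n) = n.
Proof. by rewrite /nsnd Cantor.cancel_of_to. Qed.

Lemma npair_nfst_nsnd n : npair (nfst n) (nsnd n) = n.
Proof. by rewrite /npair /nfst /nsnd -surjective_pairing Cantor.cancel_to_of. Qed.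

Definition total_computable (phi : baire -> nat -> nat) :=
  exists c, forall x n, code_eval x c n (phi x n).

Lemma total_computable_id : total_computable (fun _ n => n).
Proof.
exists (Pair Fst Snd) => x n; rewrite -{2}[n]npair_nfst_nsnd.
by constructor; rewrite -[n in code_eval _ _ n _]npair_nfst_nsnd; constructor.
Qed.

Lemma total_computable_comp phi psi : total_computable phi -> total_computable psi ->
  total_computable (fun x n => phi x (psi x n)).
Proof.
move=> [a Ha] [b Hb]; exists (Comp a b) => x n.
by apply: eval_comp; [exact: Hb|exact: Ha].
Qed.

Lemma total_computable_pair phi psi : total_computable phi -> total_computable psi ->
  total_computable (fun x n => npair (phi x n) (psi x n)).
Proof. by move=> [a Ha] [b Hb]; exists (Pair a b) => x n; constructor. Qed.

Lemma total_computable_succ phi :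
  total_computable phi -> total_computable (fun x n => (phi x n).+1).
Proof.
apply: (@total_computable_comp (fun _ n => n.+1)).
by exists Succ => x n; constructor.
Qed.

Lemma total_computable_nfst phi :
  total_computable phi -> total_computable (fun x n => nfst (phi x n)).
Proof.
apply: (@total_computable_comp (fun _ n => nfst n)).
by exists Fst => x n; rewrite -{1}[n]npair_nfst_nsnd; constructor.
Qed.

Lemma total_computable_nsnd phi :
  total_computable phi -> total_computable (fun x n => nsnd (phi x n)).
Proof.
apply: (@total_computable_comp (fun _ n => nsnd n)).
by exists Snd => x n; rewrite -{1}[n]npair_nfst_nsnd; constructor.
Qed.

Lemma total_computable_oracle phi :
  total_computable phi -> total_computable (fun x n => x (phi x n)).
Proof.
apply: (@total_computable_comp (fun x n => x n)).
by exists Oracle => x n; constructor.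
Qed.

Lemma total_computable_rec (psi theta : baire -> nat -> nat) :
  total_computable psi -> (forall x, theta x 0 = 0) ->
  (forall x k, theta x k.+1 = psi x (npair k (theta x k))) ->
  total_computable theta.
Proof.
(* [Prec] hands [npair n (npair k u)] to its step code; the parameter is a dummy 0, dropped by
   composing [psi] with [nsnd]. *)
move=> /total_computable_comp/(_ (total_computable_nsnd total_computable_id)).
move=> [b Hb] theta0 thetaS; have [c Hc] := total_computable_id.
exists (Comp (Prec Zero b) (Pair Zero c)) => x n.
apply: eval_comp; first by apply: eval_pair; [exact: eval_zero|exact: Hc].
elim: n => [|n IHn]; first by rewrite theta0; constructor; constructor.
apply: (eval_precS IHn); rewrite thetaS.
by have := Hb x (npair 0 (npair n (theta x n))); rewrite nsndK.
Qed.

Lemma total_computable_double phi :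
  total_computable phi -> total_computable (fun x n => (phi x n).*2).
Proof.
apply: (@total_computable_comp (fun _ n => n.*2)).
apply: (@total_computable_rec (fun _ w => (nsnd w).+2)) => //.
  by do 2!apply: total_computable_succ; exact/total_computable_nsnd/total_computable_id.
by move=> x k; rewrite nsndK.
Qed.

Fixpoint prefix_code (x : baire) (k : nat) : nat :=
  if k is j.+1 then npair (prefix_code x j) (x j) else 0.

Lemma prefix_codeP x y k : prefix_code x k = prefix_code y k <-> agree k x y.
Proof.
elim: k => [|k IHk] /=; first by [].
split=> [/npair_inj[/IHk xy xyk] i|xy].
  by rewrite ltnS leq_eqVlt => /orP[/eqP->//|]; exact: xy.
by rewrite (xy k) // (IHk.2 (agreeW (leqnSn k) xy)).
Qed.

Lemma total_computable_prefix phi :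
  total_computable phi -> total_computable (fun x n => prefix_code x (phi x n)).
Proof.
apply: (@total_computable_comp prefix_code).
apply: (@total_computable_rec (fun x w => npair (nsnd w) (x (nfst w)))) => //.
  apply: total_computable_pair; first exact/total_computable_nsnd/total_computable_id.
  exact/total_computable_oracle/total_computable_nfst/total_computable_id.
by move=> x k; rewrite nsndK nfstK.
Qed.

(** [Mu] finds the least witness [s], whose second component is the value. *)
Lemma computable_search phi (F : partial_fun) : total_computable phi ->
  (forall x n, pfun_dom F x -> exists s, phi x (npair n s) = 0) ->
  (forall x n s, pfun_dom F x -> phi x (npair n s) = 0 -> F x n = nsnd s) ->
  computable F.
Proof.
move=> [a Ha] phi_ex phiF; exists (Comp Snd (Mu a)) => x Fx n.
have /ex_minnP[s /eqP s0 smin] : exists s, phi x (npair n s) == 0.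
  by have [s s0] := phi_ex x n Fx; exists s; apply/eqP.
rewrite (phiF _ _ _ Fx s0); apply: (eval_comp (u := s)); last first.
  by rewrite -{1}[s]npair_nfst_nsnd; constructor.
apply: (eval_mu (w := fun j => (phi x (npair n j)).-1)); last by rewrite -s0; exact: Ha.
move=> j js; rewrite prednK; first exact: Ha.
by rewrite lt0n; apply/negP => /smin; rewrite leqNgt js.
Qed.

(** The oracle may be extracted by any computable [A] on any subdomain where [A] returns it, so that
    inputs can carry their own oracle. *)
Lemma continuous_computable_from E F : continuous_on E F -> exists alpha : baire,
  forall A : baire -> baire, total_computable A ->
  forall D, D `<=` E -> (forall x, D x -> A x = alpha) -> computable (PartialFun D F).
Proof.
(* [alpha] accepts [s = <k, v>] for the argument [n] and the prefix [p] if every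
   [y] of [E] whose prefix of length [k] is [p] satisfies [F y n = v]. *)
move=> cF; pose good n s p :=
  forall y, E y -> prefix_code y (nfst s) = p -> F y n = nsnd s.
pose alpha : baire := fun w => let s := nfst (nsnd w) in
  if pselect (good (nfst w) s (nsnd (nsnd w))) then 0 else 1.
have alphaE n s p : alpha (npair n (npair s p)) = 0 <-> good n s p.
  by rewrite /alpha !(nfstK, nsndK); case: pselect.
exists alpha => A cA D DE DA.
apply: (@computable_search (fun x w =>
  A x (npair (nfst w) (npair (nsnd w) (prefix_code x (nfst (nsnd w))))))).
- apply: total_computable_comp => //.
  have cf := total_computable_nfst total_computable_id.
  have cs := total_computable_nsnd total_computable_id.
  do 2!apply: total_computable_pair => //.
  exact/total_computable_prefix/total_computable_nfst.
- move=> x n /= Dx; have [M xM] := cF x n.+1 (DE x Dx).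
  exists (npair M (F x n)); rewrite !(nfstK, nsndK) DA //; apply/alphaE => y Ey.
  by rewrite nfstK nsndK => /prefix_codeP/agree_sym/(xM y Ey) /(_ n) ->.
- move=> x n s /= Dx; rewrite nfstK nsndK DA // => /alphaE; apply => //.
  exact: DE.
Qed.

(** * Compositional products and powers under continuous reducibility *)

Lemma computable_id D : computable (PartialFun D id).
Proof. by exists Oracle => x _ n; constructor. Qed.

Lemma leWc_refl f : leWc f f.
Proof.
apply/leWcP; exists setT, setT, odds, id; split=> //.
- exact: continuous_on_odds.
- by move=> x N _; exists N.
- by move=> x fx; split=> // y fy; rewrite bpairKr.
Qed.

(** Auxiliary problems [P] and [G], computably below [p] and [f], take instances that contain
    oracles for [k1] and for [k2] after [h1]. Maximality of [q] applies to them, and a continuous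
    reduction supplies the oracles. *)
Lemma comp_product_upper f p q f' p' :
  is_comp_product f p q -> leWc f' f -> leWc p' p -> leWc (problem_comp f' p') q.
Proof.
move=> [_ q_max] /leWcP[D2 [E2 [h2 [k2 [ch2 ck2 f'f]]]]].
move=> /leWcP[D1 [E1 [h1 [k1 [ch1 ck1 p'p]]]]].
(* The intended [v] is [bpair (bpair (bpair alpha beta) x) y], and [mid v] is [bpair x y]. *)
pose mid v := bpair (odds (evens v)) (odds v).
have [|alpha alphaP] := @continuous_computable_from (odds @^-1` E1) (k1 \o odds).
  by apply: (continuous_on_comp _ ck1) => //; exact: continuous_on_odds.
have [|beta betaP] := @continuous_computable_from
    [set v | D1 (mid v) /\ E2 (h1 (mid v))] (k2 \o (h1 \o mid)).
  apply: (continuous_on_comp _ ck2) => [|v []//].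
  apply: (continuous_on_comp _ ch1) => [|v []//].
  apply: continuous_on_bpair; last exact: continuous_on_odds.
  by apply: (@continuous_on_comp _ setT) => //;
    [exact: continuous_on_evens|exact: continuous_on_odds].
have cdouble := total_computable_double total_computable_id.
pose A (w : baire) := evens (evens w) = alpha.
pose B (w : baire) := odds (evens (evens w)) = beta.
(* Solutions are returned paired with the instance: this passes the oracles on to [G] and lets the
   identity serve as outer reduction map. *)
pose P : problem := fun w => [set v | [/\ A w, E1 (odds w) &
  exists2 y, p (k1 (odds w)) y & v = bpair w y]].
pose G : problem := fun v => [set u | [/\ B v, D1 (mid v), E2 (h1 (mid v)) &
  exists2 z, f (k2 (h1 (mid v))) z & u = bpair v z]].
have P_le : leW P p.
  exists (PartialFun setT id), (PartialFun [set w | A w /\ E1 (odds w)] (k1 \o odds)).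
  split; first exact: computable_id.
    apply: (alphaP (evens \o evens)) => [|w []//|w []//].
    exact/total_computable_oracle/total_computable_double.
  move=> w [_ [Aw Ew [y py _]]]; split=> //; first by exists y.
  by move=> y' py'; do 2!split=> //; exists y'.
have G_le : leW G f.
  exists (PartialFun setT id),
    (PartialFun [set v | B v /\ (D1 (mid v) /\ E2 (h1 (mid v)))] (k2 \o (h1 \o mid))).
  split; first exact: computable_id.
    apply: (betaP (odds \o (evens \o evens))) => [|w []//|w []//].
    apply: total_computable_oracle; do 2!apply: total_computable_double.
    exact: total_computable_succ.
  move=> v [_ [Bv Dv Ev [z fz _]]]; split=> //; first by exists z.
  by move=> z' fz'; do 2!split=> //; exists z'.
apply: (leWc_trans _ (leW_leWc (q_max G P G_le P_le))).
(* Here [t] is [bpair x (bpair (bpair w y) z)], so [in1 t] is [bpair x y] and [in2 t] is the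
   argument of [h2]. *)
pose in1 t := bpair (evens t) (odds (evens (odds t))).
pose in2 t := bpair (h1 (in1 t)) (odds (odds t)).
pose D := [set t | D1 (in1 t) /\ D2 (in2 t)].
have cin1 : continuous_on D in1.
  apply: continuous_on_bpair; first exact: continuous_on_evens.
  apply: (@continuous_on_comp _ setT) => //; last exact: continuous_on_odds.
  by apply: (@continuous_on_comp _ setT) => //;
    [exact: continuous_on_odds|exact: continuous_on_evens].
apply/leWcP; exists D, setT, (h2 \o in2), (bpair (bpair alpha beta)); split.
- apply: (continuous_on_comp _ ch2) => [|t []//].
  apply: (continuous_on_bpair (F := h1 \o in1) (G := odds \o odds)).
    by apply: (continuous_on_comp cin1 ch1) => t [].
  by apply: (@continuous_on_comp _ setT) => //; exact: continuous_on_odds.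
- apply: (continuous_on_bpair (F := fun=> bpair alpha beta) (G := id)).
    by move=> x N _; exists 0.
  by move=> x N _; exists N.
- move=> x [z0 [p'x [p'f' _]]].
  have [E1x [y0 py0] p'1] := p'p x p'x.
  set w := bpair (bpair alpha beta) x.
  have Aw : A w by rewrite /A /w !bpairKl.
  have wE : odds w = x by rewrite /w bpairKr.
  have Bwy y : B (bpair w y) by rewrite /B bpairKl /w bpairKl bpairKr.
  have midE y : mid (bpair w y) = bpair x y by rewrite /mid bpairKl wE bpairKr.
  have Pw y : p (k1 x) y -> P w (bpair w y).
    by move=> py; split; rewrite ?wE //; exists y.
  have f'h y : p (k1 x) y -> dom f' (h1 (bpair x y)).
    by move=> /p'1[_ p'y]; exact: p'f'.
  have PG : P w `<=` dom G.
    move=> _ [_ _ [y + ->]]; rewrite wE => py.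
    have [E2y [z fz] _] := f'f _ (f'h y py); have [D1y _] := p'1 y py.
    by exists (bpair (bpair w y) z); split; rewrite ?midE //; exists z.
  have dPw : dom P w by exists (bpair w y0); exact: Pw.
  split=> //.
    have [u Gu] := PG _ (Pw y0 py0).
    by exists u; split=> //; split=> //; exists (bpair w y0) => //; exact: Pw.
  move=> _ [_ [_ [_ [_ _ [y + ->]] [_ _ _ [z + ->]]]]]; rewrite midE wE => py fz.
  have [D1y p'y] := p'1 y py; have [_ _ /(_ z fz)[D2z f'z]] := f'f _ (f'h y py).
  rewrite /D /= /in2 /in1 !(bpairKl, bpairKr); do 2!split=> //.
  by split=> //; exists (h1 (bpair x y)).
Qed.

Lemma id_leWc r : dom r !=set0 -> leWc problem_id r.
Proof.
move=> [x0 rx0]; apply/leWcP; exists setT, setT, evens, (fun=> x0); split.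
- exact: continuous_on_evens.
- by move=> x N _; exists 0.
- by move=> x _; split=> // y _; rewrite bpairKl.
Qed.

Lemma leWc_comp_id g : leWc g (problem_comp g problem_id).
Proof.
apply/leWcP; exists setT, setT, odds, id; split.
- exact: continuous_on_odds.
- by move=> x N _; exists N.
- move=> x [y gy]; split=> //; last by move=> z [_ [_ [_ ->]]]; rewrite bpairKr.
  by exists y; split; [exists x|split; [move=> _ ->; exists y|exists x]].
Qed.

(** Induction on the power of [r]. Missing factors of the power of [g] are filled with [problem_id],
    which is below [r] because [r] has an instance. *)
Lemma power_leWc g r n m p q : leWc g r -> dom r !=set0 ->
  is_power g n p -> is_power r m q -> n <= m -> leWc p q.
Proof.
move=> gr r0 gp rq; elim: rq n p gp => {m q} [||m p' q rp' IH pq] n p gp.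
- by case: gp => //; rewrite /problem_id => _; exact: leWc_refl.
- by case: gp => // _; exact: id_leWc.
- have id_p' : leWc problem_id p' by apply: (IH 0) => //; constructor.
  case: gp => [_|_|n' p0 _ gp0 [[g' [p0' [gg' pp0 ->]]] _] nm].
  + exact: leWc_trans (leWc_comp_id _) (comp_product_upper pq (id_leWc r0) id_p').
  + exact: leWc_trans (leWc_comp_id _) (comp_product_upper pq gr id_p').
  + apply: (comp_product_upper pq).
      exact: leWc_trans (leW_leWc gg') gr.
    exact: leWc_trans (leW_leWc pp0) (IH _ _ gp0 nm).
Qed.

Lemma no_root I g n f : ~ clusters I g ->
  (forall r, ~ clusters I r -> leWc g r) ->
  leWc g f -> ltWc_power f g n ->
  forall m, n <= m -> ~ exists r, is_root m r f.
Proof.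
move=> ncg least gf [p gp [fp nfp]] m nm [r [q rq [fq qf]]].
have ncr : ~ clusters I r.
  move=> cr; apply: ncg; apply: (clusters_leWc (leWc_trans gf (leW_leWc fq))).
  exact: clusters_power cr rq.
have r0 : dom r !=set0 by have [a [z [rz _ _ _]]] := not_clustersP ncr; exists z.
(* As [f] is below [p], strictness is refuted by reducing [p] to [f] through [q]. *)
apply: nfp; split=> //; apply: leWc_trans (leW_leWc qf).
exact: power_leWc (least r ncr) r0 gp rq nm.
Qed.

Theorem theorem3p12 (n : nat) (f : problem) :
  2 <= n ->
  (leWc LPO f /\ ltWc_power f LPO n) \/ (leWc LLPO f /\ ltWc_power f LLPO n) ->
  forall m : nat, n <= m -> ~ (exists r : problem, is_root m r f).
Proof.
move=> _ [[LPOf fLPO]|[LLPOf fLLPO]].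
  exact: no_root LPO_not_clusters LPO_leWc LPOf fLPO.
exact: no_root LLPO_not_clusters LLPO_leWc LLPOf fLLPO.
Qed.
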